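(* Let $\mathbf{A}$ be a finite expanded group and let $\{0\}=S_0<\cdots<S_n=A$ be the set of all those ideals that cut the lattice $\mathrm{Id}(\mathbf{A})$. Suppose that for each $i\in\{0,\dots,n-1\}$, the interval $\mathbb{I}[S_i,S_{i+1}]$ of the lattice $\mathrm{Id}(\mathbf{A})$ either contains exactly the two elements $S_i$ and $S_{i+1}$, or does not split. Then the clone of congruence preserving functions of $\mathbf{A}$ is finitely generated.
   Context: An expanded group is an algebra $\mathbf{A}=(A,F)$ having operations $+$ (binary), $-$ (unary), $0$ (nullary) among its fundamental operations such that $(A,+,-,0)$ is a (not necessarily abelian) group. An ideal of $\mathbf{A}$ is a subset $I\subseteq A$ that is a normal subgroup of $(A,+)$ and satisfies $f(a_1+i_1,\dots,a_k+i_k)-f(a_1,\dots,a_k)\in I$ for every $k\in\mathbb{N}$, every $k$-ary fundamental operation $f$, all $a\in A^k$ and $i\in I^k$. The set $\mathrm{Id}(\mathbf{A})$ of ideals, with operations $+$ and $\cap$, is a lattice isomorphic to the congruence lattice of $\mathbf{A}$ via $\alpha\mapsto 0/\alpha$. A function $f:A^k\to A$ is congruence preserving if for every congruence $\alpha$ of $\mathbf{A}$ and all $(a_1,b_1),\dots,(a_k,b_k)\in\alpha$ we have $(f(a_1,\dots,a_k),f(b_1,\dots,b_k))\in\alpha$. The congruence preserving functions of all arities $k\ge1$ form a clone (a set of finitary operations containing all projections and closed under composition); it is finitely generated if it has a finite subset $F$ such that each of its members is a composition of projections and functions in $F$. For $a\le b$ in a lattice $\mathbb{L}$, $\mathbb{I}[a,b]=\{c\in\mathbb{L}:a\le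 c\le b\}$. An element $\beta$ of a bounded lattice cuts the lattice if every $\alpha$ in it satisfies $\alpha\le\beta$ or $\alpha\ge\beta$; the cutting elements form a chain containing the least and greatest elements. A bounded lattice $\mathbb{L}$ with least element $\mathbf 0$ and greatest element $\mathbf 1$ splits if there are $\delta,\varepsilon\in\mathbb{L}$ with $\delta<\mathbf 1$, $\varepsilon>\mathbf 0$ such that every $\alpha\in\mathbb{L}$ satisfies $\alpha\le\delta$ or $\alpha\ge\varepsilon$. *)

(* Defs.v *)
From HB Require Import structures.
From mathcomp Require Import all_boot all_order all_fingroup.
From mathcomp Require Import boolp.
Set Implicit Arguments.
Unset Strict Implicit.
Unset Printing Implicit Defensive.

Local Open Scope group_scope.

Definition operation (T : finType) (k : nat) := {ffun k.-tuple T -> T}.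

(* The group (A, +, -, 0) need not be abelian; it is the underlying           *)
(* finGroupType, so + is written *, - is ^-1 and 0 is 1.                      *)
Definition add_op (gT : finGroupType) : operation gT 2 :=
  [ffun t : 2.-tuple gT => tnth t ord0 * tnth t ord_max].
Definition opp_op (gT : finGroupType) : operation gT 1 :=
  [ffun t : 1.-tuple gT => (tnth t ord0)^-1].
Definition zero_op (gT : finGroupType) : operation gT 0 :=
  [ffun _ : 0.-tuple gT => 1].

(* fund k is the set of k-ary fundamental operations. There are finitely many *)
(* k-ary operations on a finite set for each k, but infinitely many arities   *)
(* may occur.                                                                 *)
Record expandedGroup := ExpandedGroup {
  eg_group :> finGroupType;
  fund : forall k, {set operation eg_group k};
  add_fund : add_op eg_group \in fund 2;
  opp_fund : opp_op eg_group \in fund 1;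
  zero_fund : zero_op eg_group \in fund 0
}.

(* f (a + i) - f a \in I *)
Definition is_ideal (A : expandedGroup) (I : {group A}) : Prop :=
  I <| [set: A] /\
  forall k (f : operation A k), f \in fund A k ->
  forall a i : k.-tuple A, (forall j, tnth i j \in I) ->
    f [tuple tnth a j * tnth i j | j < k] * (f a)^-1 \in I.

Fact ideal_display : Order.disp_t. Proof. exact: Order.Disp tt tt. Qed.

Record ideal (A : expandedGroup) := Ideal {
  ideal_group :> {group A};
  _ : `[< is_ideal ideal_group >]
}.

HB.instance Definition _ A := [isSub for @ideal_group A].
HB.instance Definition _ A := [Finite of ideal A by <:].

Section IdealLattice.
Variable A : expandedGroup.
Implicit Types I J K : ideal A.

Lemma idealP I : is_ideal I.
Proof. by apply/asboolP; case: I. Qed.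

Lemma is_ideal1 : is_ideal (1%G : {group A}).
Proof.
split=> [|k f _ a i i1]; first exact: normal1.
have -> : [tuple tnth a j * tnth i j | j < k] = a.
  by apply: eq_from_tnth => j; rewrite tnth_mktuple (set1P (i1 j)) mulg1.
by rewrite mulgV group1.
Qed.

Lemma is_idealT : is_ideal [set: A]%G.
Proof. by split=> [|*]; [exact: normal_refl | exact: in_setT]. Qed.

Lemma is_idealI I J : is_ideal (I :&: J)%G.
Proof.
have [[nI fI] [nJ fJ]] := (idealP I, idealP J).
split=> [|k f fF a i iIJ]; first exact: normalI.
by apply/setIP; split; [apply: fI | apply: fJ] => // j; case/setIP: (iIJ j).
Qed.

Lemma ideal_mulE I J : (I <*> J)%g = (I * J)%g.
Proof.
have [[nI _] [nJ _]] := (idealP I, idealP J).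
by rewrite norm_joinEr // (subset_trans (subsetT J)) // normal_norm.
Qed.

Lemma is_idealM I J : is_ideal (I <*> J)%G.
Proof.
have [[nI fI] [nJ fJ]] := (idealP I, idealP J).
split=> [|k f fF a i]; first exact: normalY.
rewrite /= ideal_mulE => iIJ.
have /fin_all_exists2[x xI] : forall j, exists2 x, x \in I &
    x^-1 * tnth i j \in J.
  move=> j; have /mulsgP[x y xI yJ ->] := iIJ j.
  by exists x => //; rewrite mulKg.
move=> yJ; pose ax := [tuple tnth a j * x j | j < k].
have IJC : (I * J = J * I)%g.
  apply: normC; apply: (subset_trans (subsetT I)); exact: normal_norm.
rewrite IJC.
rewrite -(mulgKV (f ax) (f _)) -mulgA; apply: mem_mulg.
- have -> : [tuple tnth a j * tnth i j | j < k] =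
    [tuple tnth ax j * tnth [tuple (x j)^-1 * tnth i j | j < k] j | j < k].
    by apply: eq_from_tnth => j; rewrite !tnth_mktuple -mulgA mulKVg.
  by apply: fJ => // j; rewrite tnth_mktuple.
- have -> : ax = [tuple tnth a j * tnth [tuple x j | j < k] j | j < k].
    by apply: eq_from_tnth => j; rewrite !tnth_mktuple.
  by apply: fI => // j; rewrite tnth_mktuple.
Qed.

Definition ideal0 : ideal A := Ideal (asboolT is_ideal1).
Definition idealT : ideal A := Ideal (asboolT is_idealT).
Definition ideal_meet I J : ideal A := Ideal (asboolT (is_idealI I J)).
(* By ideal_mulE the carrier of the join is the sum I + J. *)
Definition ideal_join I J : ideal A := Ideal (asboolT (is_idealM I J)).
Definition ideal_le I J := I \subset J.

Lemma ideal_le_refl : reflexive ideal_le.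
Proof. by move=> I; exact: subxx. Qed.

Lemma ideal_le_anti : antisymmetric ideal_le.
Proof.
move=> I J IJ; do 2!apply: val_inj.
by apply/eqP; rewrite eqEsubset.
Qed.

Lemma ideal_le_trans : transitive ideal_le.
Proof. by move=> J I K; exact: subset_trans. Qed.

HB.instance Definition _ := Order.Le_isPOrder.Build ideal_display
  (ideal A) ideal_le_refl ideal_le_anti ideal_le_trans.

Lemma ideal_lexI I J K : (I <= ideal_meet J K)%O = (I <= J)%O && (I <= K)%O.
Proof. exact: subsetI. Qed.

Lemma ideal_leUx I J K : (ideal_join I J <= K)%O = (I <= K)%O && (J <= K)%O.
Proof. exact: join_subG. Qed.

HB.instance Definition _ := Order.POrder_isMeetSemilattice.Build
  ideal_display (ideal A) ideal_lexI.
HB.instance Definition _ := Order.POrder_isJoinSemilattice.Build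
  ideal_display (ideal A) ideal_leUx.

Lemma ideal_le0x I : (ideal0 <= I)%O.
Proof. exact: sub1G. Qed.

Lemma ideal_lex1 I : (I <= idealT)%O.
Proof. exact: subsetT. Qed.

HB.instance Definition _ := Order.hasBottom.Build
  ideal_display (ideal A) ideal_le0x.
HB.instance Definition _ := Order.hasTop.Build
  ideal_display (ideal A) ideal_lex1.

End IdealLattice.

Definition cuts d (L : tbLatticeType d) (b : L) : Prop :=
  forall a : L, (a <= b)%O \/ (b <= a)%O.

Definition in_interval d (L : latticeType d) (a b c : L) : Prop :=
  (a <= c)%O /\ (c <= b)%O.

(* The interval I[a, b], as a bounded lattice with least element a and        *)
(* greatest element b, splits.                                                *)
Definition interval_splits d (L : latticeType d) (a b : L) : Prop :=
  exists delta eps : L,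
    [/\ in_interval a b delta, in_interval a b eps,
        (delta < b)%O, (a < eps)%O &
        forall c, in_interval a b c -> (c <= delta)%O \/ (eps <= c)%O].

Definition is_congruence (A : expandedGroup) (R : rel A) : Prop :=
  equivalence_rel R /\
  forall k (f : operation A k), f \in fund A k ->
  forall a b : k.-tuple A, (forall j, R (tnth a j) (tnth b j)) -> R (f a) (f b).

Definition congruence_preserving (A : expandedGroup) k (f : operation A k) :
    Prop :=
  forall R : rel A, is_congruence R ->
  forall a b : k.-tuple A, (forall j, R (tnth a j) (tnth b j)) -> R (f a) (f b).

Definition cp_clone (A : expandedGroup) k (f : operation A k) : Prop :=
  (0 < k)%N /\ congruence_preserving f.

Definition proj_op (T : finType) k (j : 'I_k) : operation T k :=
  [ffun t : k.-tuple T => tnth t j].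

Definition comp_op (T : finType) m k (f : operation T m)
    (g : 'I_m -> operation T k) : operation T k :=
  [ffun t : k.-tuple T => f [tuple g j t | j < m]].

Inductive generated (T : finType) (G : seq {k : nat & operation T k}) :
    forall k, operation T k -> Prop :=
| gen_proj k (j : 'I_k) : generated G (proj_op T j)
| gen_mem k (f : operation T k) :
    Tagged (operation T) f \in G -> generated G f
| gen_comp m k (f : operation T m) (g : 'I_m -> operation T k) :
    generated G f -> (forall j, generated G (g j)) ->
    generated G (comp_op f g).

Definition finitely_generated (T : finType)
    (C : forall k, operation T k -> Prop) : Prop :=
  exists G : seq {k : nat & operation T k},
    (forall k (f : operation T k), Tagged (operation T) f \in G -> C k f) /\
    (forall k (f : operation T k), C k f -> generated G f).

(* Main.v *)
Require Import Defs.
From mathcomp Require Import all_boot all_order all_fingroup.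
From mathcomp Require Import boolp.

(** Congruences of an expanded group are the cosets of ideals, so an operation
preserves congruences exactly when it is compatible with every ideal.  The
clone is generated by the congruence preserving operations of arity at most
some bound [B].

The chain of cutting ideals is climbed down: suppose that [f] agrees modulo [H]
with a generated operation, where [H] is a cutting ideal and [L] the one just
below it.  Dividing, we may assume that [f] has its values in [H], and have to
find a generated operation that agrees with [f] modulo [L] ([gen_layer]).
Because every ideal is comparable with [L] and with [H], only the ideals between
them matter: a function with values in [H] that preserves these becomes
congruence preserving once its values are replaced by representatives modulo
[L] ([cp_rep]).  This supplies all the operations of small arity that are
needed.

Let [K] be [L] when nothing lies strictly between [L] and [H], and [H] when the
interval does not split.  No ideal between [L] and [H] relates different cosets
of [K] without containing [H], so the restrictions of [f] to the various cosets
of [K ^ k] can be generated separately and multiplied; a binary gate, applied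
once per variable, confines a function to one such coset ([gen_gated]).

On one coset, [f] is recentred at the identity and written as a product of
functions each of whose variables is either irrelevant or absorbing, meaning
that the value is trivial modulo [L] as soon as that variable is [1].  What makes
the arity bounded is that a function with many absorbing variables vanishes
modulo [L].  If [K = L] one absorbing variable suffices.  If the interval does
not split, a higher commutator argument applies.  For [d] in the interval below
[K], let [X d] consist of the members of the interval that are not below [d].  By
non-splitting, the meet of [X d] is [L].  If [c] chooses an element of each
[X d], the join of all [c d] is [K], since it cannot be one of the [d].  Take one
absorbing variable for each choice function [c].  As in the multilinearity of
higher commutators, it is enough to treat the variable of [c] as ranging over a
single [c (phi c)].  A diagonal argument gives one [d] for which these ideals
include all of [X d]; the value lies in every one of them, hence in [L]
([absorbing_vanish_nonsplitting]). *)

Set Implicit Arguments.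
Unset Strict Implicit.
Unset Printing Implicit Defensive.

Import Order.LTheory.

(** * Ideals and congruences *)

Section Congruence.
Local Open Scope group_scope.
Variable A : expandedGroup.
Implicit Types (I J K : ideal A) (x y z : A).

Definition eqm I x y := x * y^-1 \in I.

Lemma ideal_conj I x y : (y ^ x \in I) = (y \in I).
Proof. by rewrite memJ_norm // (subsetP (normal_norm (idealP I).1)) ?inE. Qed.

Lemma eqm1 I x : eqm I x 1 = (x \in I).
Proof. by rewrite /eqm invg1 mulg1. Qed.

Lemma eqm_refl I x : eqm I x x.
Proof. by rewrite /eqm mulgV group1. Qed.

Lemma eqm_sym I x y : eqm I x y = eqm I y x.
Proof. by rewrite /eqm -groupV invMg invgK. Qed.

Lemma eqm_trans I y x z : eqm I x y -> eqm I y z -> eqm I x z.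
Proof. by move=> xy yz; have := groupM xy yz; rewrite mulgA mulgKV. Qed.

Lemma eqm_mul I x x' y y' : eqm I x y -> eqm I x' y' -> eqm I (x * x') (y * y').
Proof.
move=> xy xy'; apply: (@eqm_trans _ (x * y')); last first.
  by rewrite /eqm invMg mulgA mulgK.
rewrite /eqm; have -> : x * x' * (x * y')^-1 = (x' * y'^-1) ^ x^-1.
  by rewrite conjgE invgK invMg !mulgA.
by rewrite ideal_conj.
Qed.

Lemma eqm_inv I x y : eqm I x y -> eqm I x^-1 y^-1.
Proof.
move=> xy; rewrite /eqm invgK -(ideal_conj _ y^-1) conjgE invgK.
by rewrite !mulgA mulgK -groupV invMg invgK.
Qed.

Lemma eqm_sub I J x y : (I <= J)%O -> eqm I x y -> eqm J x y.
Proof. by move=> IJ; apply: (subsetP IJ). Qed.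

Lemma eqm_mem I x y : eqm I x y -> (x \in I) = (y \in I).
Proof. by move=> xy; rewrite -[x](mulgKV y) groupMl. Qed.

Lemma eqm_in I x y : x \in I -> y \in I -> eqm I x y.
Proof. by move=> xI yI; rewrite /eqm groupM ?groupV. Qed.

Definition compatible k I (f : operation A k) := forall a b : k.-tuple A,
  (forall j, eqm I (tnth a j) (tnth b j)) -> eqm I (f a) (f b).

(** An ideal condition compares [f (a + i)] with [f a]; a congruent [b] is put in
this form by taking for [i] the differences, which lie in [I] on either side by
normality. *)
Lemma eqm_congruence I : is_congruence (eqm I).
Proof.
split=> [x y z|k f fF a b ab].
  split=> [|xy]; first exact: eqm_refl.
  by apply/idP/idP; apply: eqm_trans => //; rewrite eqm_sym.
rewrite eqm_sym /eqm.
have -> : b = [tuple tnth a j * tnth [tuple (tnth a i)^-1 * tnth b i | i < k] j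
                | j < k].
  by apply: eq_from_tnth => j; rewrite !tnth_mktuple mulKVg.
apply: (idealP I).2 => // j; rewrite tnth_mktuple.
by have := eqm_inv (ab j); rewrite /eqm invgK.
Qed.

(** The ideal is the class of the identity; left and right translations, being
compatible with [R], transport it to all other classes. *)
Lemma congruence_ideal (R : rel A) :
  is_congruence R -> exists I : ideal A, R =2 eqm I.
Proof.
case=> eqR opR.
have Rxx x : R x x by have [] := eqR x x x.
have Rtr x y z : R x y -> R y z -> R x z.
  by move=> xy yz; have [_ ->] := eqR x y z.
have Rmul x x' y y' : R x x' -> R y y' -> R (x * y) (x' * y').
  move=> xx' yy'.
  have := opR 2%N _ (add_fund A) [tuple x; y] [tuple x'; y'].
  rewrite !ffunE !(tnth_nth 1) /=; apply.
  by case=> [[|[|//]] ?]; rewrite !(tnth_nth 1).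
have Rinv x x' : R x x' -> R x^-1 x'^-1.
  move=> xx'; have := opR 1%N _ (opp_fund A) [tuple x] [tuple x'].
  rewrite !ffunE !(tnth_nth 1) /=; apply.
  by case=> [[|//] ?]; rewrite !(tnth_nth 1).
pose I0 := [set x | R x 1].
have gI : group_set I0.
  apply/group_setP; split=> [|x y]; rewrite !inE // => x1 y1.
  by have := Rmul _ _ _ _ x1 y1; rewrite mulg1.
have idI : is_ideal (Group gI).
  split=> [|k f fF a i iI].
    apply/normalP; split; first exact: subsetT.
    suff sub y : I0 :^ y \subset I0.
      move=> y _; apply/eqP; rewrite eqEsubset sub /=.
      by rewrite -sub_conjgV sub.
    apply/subsetP => _ /imsetP[x + ->]; rewrite !inE => x1.
    have := Rmul _ _ _ _ (Rxx y^-1) (Rmul _ _ _ _ x1 (Rxx y)).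
    by rewrite mul1g mulVg.
  rewrite inE -[X in R _ X](mulgV (f a)); apply: (Rmul) => //.
  apply: opR => // j; rewrite tnth_mktuple -[X in R _ X]mulg1.
  by apply: Rmul => //; have := iI j; rewrite inE.
exists (Ideal (asboolT idI)) => x y.
rewrite /eqm inE; apply/idP/idP => xy.
  by rewrite -(mulgV y); apply: Rmul.
by rewrite -[y]mul1g -[x](mulgKV y); apply: Rmul.
Qed.

Lemma cpP k (f : operation A k) :
  congruence_preserving f <-> forall I, compatible I f.
Proof.
split=> [cpf I a b ab|cf R /congruence_ideal[I RI] a b ab].
  by apply: cpf; first exact: eqm_congruence.
by rewrite RI; apply: cf => j; rewrite -RI.
Qed.

End Congruence.

(** * Functions with many absorbing variables vanish *)

Section Absorbing.
Local Open Scope group_scope.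
Variable A : expandedGroup.
Implicit Types (I J : ideal A).

Definition all_in I k (x : k.-tuple A) := forall j, tnth x j \in I.

Definition upd k (x : k.-tuple A) (j : 'I_k) (y : A) : k.-tuple A :=
  [tuple if i == j then y else tnth x i | i < k].

Lemma tnth_upd k (x : k.-tuple A) j y i :
  tnth (upd x j y) i = if i == j then y else tnth x i.
Proof. exact: tnth_mktuple. Qed.

Lemma upd_id k (x : k.-tuple A) j : upd x j (tnth x j) = x.
Proof.
by apply: eq_from_tnth => i; rewrite tnth_upd; case: eqP => // ->.
Qed.

Lemma upd_upd k (x : k.-tuple A) j y z : upd (upd x j y) j z = upd x j z.
Proof. by apply: eq_from_tnth => i; rewrite !tnth_upd; case: eqP. Qed.

Lemma all_in_upd I k (x : k.-tuple A) j y :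
  all_in I x -> y \in I -> all_in I (upd x j y).
Proof. by move=> xI yI i; rewrite tnth_upd; case: eqP. Qed.

Lemma eqm_upd I k (x y : k.-tuple A) j u v :
    (forall i, eqm I (tnth x i) (tnth y i)) -> eqm I u v ->
  forall i, eqm I (tnth (upd x j u) i) (tnth (upd y j v) i).
Proof. by move=> xy uv i; rewrite !tnth_upd; case: eqP. Qed.

Section Interval.
Variables L K : ideal A.

(** This is compatibility with the ideals of the interval for functions that are
only looked at on [K ^ k]; values need not lie in [K]. *)
Definition preserving k (f : k.-tuple A -> A) :=
  forall I, (L <= I)%O -> (I <= K)%O ->
  forall x y, all_in K x -> all_in K y ->
  (forall j, eqm I (tnth x j) (tnth y j)) -> eqm I (f x) (f y).

Definition absorbs k (f : k.-tuple A -> A) (j : 'I_k) :=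
  forall x, all_in K x -> tnth x j = 1 -> f x \in L.

(** In commutator terms: the [N]-ary higher commutator of [K] is contained in
[L]. *)
Definition absorbing_vanish N :=
  forall k (f : k.-tuple A -> A) (s : {set 'I_k}), (N <= #|s|)%N ->
  preserving f -> (forall j, j \in s -> absorbs f j) ->
  forall x, all_in K x -> f x \in L.

(** Replacing an absorbing argument from [I] by [1] changes the value only modulo
[I], and makes it trivial. *)
Lemma absorbs_mem k (f : k.-tuple A -> A) j I x :
  preserving f -> absorbs f j -> (L <= I)%O -> (I <= K)%O ->
  all_in K x -> tnth x j \in I -> f x \in I.
Proof.
move=> pf af LI IK xK xI.
have x1K : all_in K (upd x j 1) by apply: all_in_upd.
rewrite (@eqm_mem _ _ _ (f (upd x j 1))).
  by apply: (subsetP LI); apply: af => //; rewrite tnth_upd eqxx.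
apply: pf => // i; rewrite tnth_upd; case: eqP => [->|_]; last exact: eqm_refl.
by rewrite eqm1.
Qed.

Lemma preserving_mul k (f g : k.-tuple A -> A) :
  preserving f -> preserving g -> preserving (fun x => f x * g x).
Proof.
by move=> pf pg I LI IK x y xK yK xy; apply: eqm_mul; [apply: pf | apply: pg].
Qed.

Lemma preserving_inv k (f : k.-tuple A -> A) :
  preserving f -> preserving (fun x => (f x)^-1).
Proof. by move=> pf I LI IK x y xK yK xy; apply: eqm_inv; apply: pf. Qed.

Lemma preserving_upd k (f : k.-tuple A -> A) j y : y \in K ->
  preserving f -> preserving (fun x => f (upd x j y)).
Proof.
move=> yK pf I LI IK x z xK zK xz; apply: pf => //; try exact: all_in_upd.
by apply: eqm_upd => //; apply: eqm_refl.
Qed.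

Lemma preserving_shift k (f : k.-tuple A -> A) j y : y \in K ->
  preserving f -> preserving (fun x => f (upd x j (y * tnth x j))).
Proof.
move=> yK pf I LI IK x z xK zK xz; apply: pf => //.
- by apply: all_in_upd; rewrite ?groupM.
- by apply: all_in_upd; rewrite ?groupM.
by apply: eqm_upd => //; apply: eqm_mul => //; apply: eqm_refl.
Qed.

End Interval.

Lemma absorbing_vanish_refl L N : (0 < N)%N -> absorbing_vanish L L N.
Proof.
move=> N0 k f s Ns pf af x xL.
have /card_gt0P[j js] := leq_trans N0 Ns.
exact: absorbs_mem pf (af j js) _ _ _ _.
Qed.

Section NonSplitting.
Variables L K : ideal A.
Hypothesis LK : (L < K)%O.
Hypothesis nosplit : ~ interval_splits L K.

(** The choice functions: [C] is the type of all functions on ideals, read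
through [e], which repairs a wrong choice at [d] to [K].  This keeps the index
type a plain finite function type, and [e c d] always lies in [X d] when [d] is a
proper element of the interval. *)
Let X (d a : ideal A) := [&& (L <= a)%O, (a <= K)%O & ~~ (a <= d)%O].
Let D (d : ideal A) := (L <= d)%O && (d < K)%O.
Let C := {ffun ideal A -> ideal A}.
Let e (c : C) d := if X d (c d) then c d else K.
Let joins c t := foldr (@ideal_join A) L [seq e c d | d <- t].

Local Lemma eX c d : D d -> X d (e c d).
Proof.
rewrite /e; case: ifP => // _ /andP[Ld dK].
by rewrite /X (ltW LK) lexx /=
  lt_geF.
Qed.

Local Lemma eK c d : (e c d <= K)%O.
Proof. by rewrite /e; case: ifP => [/and3P[]|]. Qed.

Local Lemma joinsK c t : (L <= joins c t)%O /\ (joins c t <= K)%O.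
Proof.
elim: t => [|d t [Lt tK]] /=.
  by split=> //; apply: ltW.
split; last by rewrite [(_ <= K)%O]ideal_leUx eK.
apply: le_trans Lt _.
exact: leUr.
Qed.

Local Lemma joins_sup c t d : d \in t -> (e c d <= joins c t)%O.
Proof.
elim: t => //= d' t IH; rewrite inE => /orP[/eqP->|/IH le_t].
  exact: leUl.
apply: le_trans le_t _.
exact: leUr.
Qed.

(** If the join [d] of all choices were proper, the choice made at [d] itself would
not be below it. *)
Local Lemma joins_total c : (K <= joins c (enum D))%O.
Proof.
set d := joins c _; have [Ld dK] := joinsK c (enum D).
apply/negPn/negP => nKd.
have Dd : D d.
  rewrite /D Ld lt_neqAle dK andbT.
  by apply/eqP => dE; move: nKd; rewrite dE lexx.
have /and3P[_ _ /negP[]] := eX c Dd.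
by apply: joins_sup; rewrite mem_enum.
Qed.

(** This is where non-splitting enters: if the meet [m] of [X d] were larger than
[L], every member of the interval would be below [d] or above [m]. *)
Local Lemma meet_escaping d y : D d ->
  (forall a, X d a -> y \in a) -> y \in L.
Proof.
move=> Dd yX.
pose m : ideal A := (\meet_(a | X d a) a)%O.
have mem_m z : (forall a, X d a -> z \in a) -> z \in m.
  move=> zX; apply: (big_ind (fun I : ideal A => z \in I)) => [|I J zI zJ|a /zX //].
    by rewrite -[z \in _]/(z \in [set: A]) inE.
  by rewrite -[z \in _]/(z \in I :&: J) inE zI.
have ym := mem_m y yX.
have mX a : X d a -> (m <= a)%O by move=> Xa; apply: meets_inf.
have Lm : (L <= m)%O.
  apply/subsetP => z zL; apply: mem_m => a /and3P[La _ _].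
  exact: (subsetP La).
have mK : (m <= K)%O.
  apply: mX; have := eX [ffun=> K] Dd.
  by rewrite /e ffunE; case: ifP => // ->.
case: (eqVneq L m) => [-> //|nLm]; case: nosplit.
have /andP[Ld dK] := Dd.
exists d, m; split=> //.
- by split=> //; apply: ltW.
- by rewrite lt_neqAle nLm.
move=> c [Lc cK]; case: (boolP (c <= d)%O) => [|ncd]; first by left.
by right; apply: mX; rewrite /X Lc cK.
Qed.

Section Labelled.
Variables (k : nat) (s : {set 'I_k}) (lab : 'I_k -> C).
Hypothesis lab_onto : forall c, exists2 j, j \in s & lab j = c.

(** Diagonalisation: if for each [d] some member of [X d] were missed, choosing
these missed members would define a choice function [c]; but a variable labelled
by [c] meets the member that [c] chose at its own value of [phi]. *)
Local Lemma exhausted_member (phi : 'I_k -> ideal A) :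
    (forall j, D (phi j)) ->
  exists2 d, D d & forall a, X d a -> exists2 j, j \in s & e (lab j) (phi j) = a.
Proof.
move=> Dphi.
pose c : C := [ffun d => odflt L [pick a | X d a &
  [forall j in s, (phi j == d) ==> (e (lab j) d != a)]]].
have [j js labj] := lab_onto c.
exists (phi j) => // a Xa; apply: contrapT => no_j.
have [ca_X ca_new] : X (phi j) (c (phi j)) /\ 
    [forall i in s, (phi i == phi j) ==> (e (lab i) (phi j) != c (phi j))].
  rewrite ffunE; case: pickP => [a' /andP[]//|/(_ a)/negP[]].
  rewrite Xa; apply/forall_inP => i si; apply/implyP => /eqP Ei.
  by apply/eqP => ea; apply: no_j; exists i => //; rewrite Ei.
have := forall_inP ca_new _ js; rewrite eqxx labj /e ca_X.
by rewrite eqxx.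
Qed.

(** The variables in [r] have been freed from their ideals [e (lab j) (phi j)] and
range over all of [K].  A further variable is freed by joining ideals one at a
time; since elements of a join are products, the step is the join-distributivity
of higher commutators. *)
Local Lemma vanish_partial (r : seq 'I_k) (phi : 'I_k -> ideal A) :
    (forall j, D (phi j)) ->
  forall f : k.-tuple A -> A, preserving L K f ->
    (forall j, j \in s -> absorbs L K f j) ->
  forall x, all_in K x ->
    (forall j, j \in s -> j \notin r -> tnth x j \in e (lab j) (phi j)) ->
  f x \in L.
Proof.
elim: r phi => [|j r IH] phi Dphi.
  move=> f pf af x xK xe.
  have [d Dd dX] := exhausted_member Dphi.
  apply: meet_escaping Dd _ => a Xa; have [j js ja] := dX _ Xa.
  have /and3P[La aK _] := Xa.
  by apply: absorbs_mem pf (af j js) _ _ _ _ => //; rewrite -ja xe.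
case: (boolP (j \in s)) => [js|njs]; last first.
  move=> f pf af x xK xe; apply: (IH phi) => // i si nir; apply: xe => //.
  by rewrite inE negb_or nir andbT; apply: contraNneq njs => <-.
suff H t : all D t -> forall f, preserving L K f ->
    (forall j, j \in s -> absorbs L K f j) ->
    forall x, all_in K x ->
    (forall i, i \in s -> i \notin j :: r -> tnth x i \in e (lab i) (phi i)) ->
    tnth x j \in joins (lab j) t -> f x \in L.
  move=> f pf af x xK xe; apply: (H (enum D)) => //.
    by apply/allP => d; rewrite mem_enum.
  exact: (subsetP (joins_total (lab j))).
elim: t => [_|d t IHt /= /andP[Dd Dt]] f pf af x xK xe.
  by apply: absorbs_mem pf (af j js) _ _ _ => //; apply: ltW.
rewrite /joins /= ideal_mulE => /mulsgP[y z ye zt xj].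
have yK : y \in K by apply: (subsetP (eK (lab j) d)).
have zK : z \in K by apply: (subsetP (joinsK (lab j) t).2).
have xuE u i : i \in s -> i \notin j :: r ->
    tnth (upd x j u) i \in e (lab i) (phi i).
  move=> si nir; rewrite tnth_upd ifN ?xe //.
  by apply: contraNneq nir => ->; rewrite inE eqxx.
have fy : f (upd x j y) \in L.
  apply: (IH (fun i => if i == j then d else phi i)) => //.
  - by move=> i; case: eqP.
  - exact: all_in_upd.
  move=> i si nir; rewrite tnth_upd; case: eqP => [-> //|/eqP nij].
  by apply: xe => //; rewrite inE negb_or nij.
have fz : f (upd x j z) \in L.
  apply: IHt => //; [exact: all_in_upd | exact: xuE |].
  by rewrite tnth_upd eqxx.
(* The defect of multiplicativity of f in variable j; it is again absorbing,
   also in j, so the induction hypothesis applies to it at z. *)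
pose g (v : k.-tuple A) :=
  f (upd v j (y * tnth v j)) * (f v)^-1 * (f (upd v j y))^-1.
have gz : g (upd x j z) \in L.
  apply: IHt => //.
  - apply: preserving_mul; last by apply/preserving_inv/preserving_upd.
    by apply: preserving_mul; [apply: preserving_shift | apply: preserving_inv].
  - move=> i si v vK vi; rewrite /g; case: (eqVneq i j) => [ij|nij].
      rewrite -ij vi mulg1 -mulgA -{1}[f (upd v i y)]invgK -conjgE.
      by rewrite ideal_conj groupV (af i).
    rewrite !groupM ?groupV ?(af i) //; try exact: all_in_upd.
    - by apply: all_in_upd; rewrite ?groupM.
    - by rewrite tnth_upd (negPf nij).
    - by rewrite tnth_upd (negPf nij).
  - exact: all_in_upd.
  - exact: xuE.
  by rewrite tnth_upd eqxx.
move: gz; rewrite /g tnth_upd eqxx -xj !upd_upd upd_id.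
by rewrite !groupMr ?groupV.
Qed.

End Labelled.

Lemma absorbing_vanish_nonsplitting : absorbing_vanish L K #|{: C}|.
Proof.
move=> k f s Cs pf af x xK.
pose lab (j : 'I_k) : C := nth [ffun=> L] (enum C) (index j (enum s)).
apply: (@vanish_partial k s lab _ (enum 'I_k) (fun=> L)) => //.
- move=> c; have ic : (index c (enum C) < #|s|)%N.
    by apply: leq_trans Cs; rewrite cardE index_mem mem_enum.
  have /card_gt0P[j0 _] : (0 < #|s|)%N by apply: leq_ltn_trans ic.
  exists (nth j0 (enum s) (index c (enum C))).
    by rewrite -mem_enum mem_nth -?cardE.
  by rewrite /lab index_uniq ?enum_uniq -?cardE // nth_index ?mem_enum.
- by move=> j; rewrite /D LK lexx.
by move=> j _; rewrite mem_enum.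
Qed.

End NonSplitting.
End Absorbing.

(** * Generating one layer of the chain *)

Section Generation.
Local Open Scope group_scope.
Variable A : expandedGroup.
Variable B : nat.
Hypothesis B_gt1 : (1 < B)%N.

Definition small_cp : seq {k : nat & operation A k} :=
  flatten [seq [seq Tagged (operation A) f |
      f <- enum {: operation A k} & `[< congruence_preserving f >]]
    | k <- iota 1 B].

Lemma small_cpP (u : {k : nat & operation A k}) :
  u \in small_cp <->
    (0 < tag u <= B)%N /\ congruence_preserving (tagged u).
Proof.
split.
  case/flatten_mapP => k; rewrite mem_iota add1n ltnS => kB /mapP[f].
  by rewrite mem_filter => /andP[/asboolP cpf _] ->.
case: u => k f /= [kB cpf]; apply/flatten_mapP.
exists k; first by rewrite mem_iota add1n ltnS.
by apply: map_f; rewrite mem_filter mem_enum andbT; apply/asboolP.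
Qed.

Definition gen k (f : operation A k) := Defs.generated small_cp f.

Lemma gen_small k (f : operation A k) :
  (0 < k <= B)%N -> congruence_preserving f -> gen f.
Proof. by move=> kB cpf; apply: gen_mem; apply/small_cpP. Qed.

Lemma gen_cp k (f : operation A k) : gen f -> congruence_preserving f.
Proof.
elim=> {k f} [k j|k f /small_cpP[] //|m k f g _ cpf _ cpg].
  by move=> R _ a b ab; rewrite !ffunE.
move=> R cR a b ab; rewrite !ffunE; apply: cpf => // j.
by rewrite !tnth_mktuple; apply: cpg.
Qed.

Lemma gen_binary (h : A -> A -> A) k (f g : operation A k) :
    (forall (I : ideal A) x x' y y',
       eqm I x x' -> eqm I y y' -> eqm I (h x y) (h x' y')) ->
  gen f -> gen g -> gen [ffun x => h (f x) (g x)].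
Proof.
move=> hE gf gg.
pose F : operation A 2 := [ffun t : 2.-tuple A => h (tnth t ord0) (tnth t ord_max)].
have genF : gen F.
  apply: gen_small => //; apply/cpP => I a b ab; rewrite !ffunE.
  exact: hE.
have := gen_comp genF (g := fun j => if j == ord0 then f else g).
move=> /(_ _); set G := comp_op _ _ => genG.
have -> : [ffun x => h (f x) (g x)] = G.
  by apply/ffunP => x; rewrite !ffunE !tnth_mktuple.
by apply: genG => j; case: ifP.
Qed.

Lemma gen_mul k (f g : operation A k) :
  gen f -> gen g -> gen [ffun x => f x * g x].
Proof.
by move=> gf gg; apply: (gen_binary (h := fun x y => x * y)) => // *; exact: eqm_mul.
Qed.

Lemma gen_one k : (0 < k)%N -> gen ([ffun=> 1] : operation A k).
Proof.
move=> k0; have gp := gen_proj small_cp (Ordinal k0).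
have := gen_binary (h := fun _ _ => 1) (fun _ _ _ _ _ _ _ => eqm_refl _ _) gp gp.
by congr gen; apply/ffunP => x; rewrite !ffunE.
Qed.

Section Layer.
Variables L K H : ideal A.
Hypotheses (LK : (L <= K)%O) (KH : (K <= H)%O).
Hypotheses (cutL : cuts L) (cutH : cuts H).
Hypothesis gap : forall I, (L <= I)%O -> (I <= H)%O -> (I <= K)%O \/ (H <= I)%O.

Definition rep (v : A) := repr (L :* v).

Lemma eqm_rep v : eqm L (rep v) v.
Proof. by rewrite /eqm -mem_rcoset mem_repr_rcoset. Qed.

Lemma rep_eq u v : eqm L u v -> rep u = rep v.
Proof. by rewrite /eqm -mem_rcoset => /rcoset_eqP uv; rewrite /rep uv. Qed.

(** Ideals below [L] see nothing: the class of [F x] modulo [L] depends only on that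
of [x], so [rep (F x)] is constant on classes.  Ideals above [H] see nothing because
the values lie in [H].  As [L] and [H] cut, the ideals between them are the only others. *)
Lemma cp_rep k (F : k.-tuple A -> A) : (forall x, F x \in H) ->
    (forall I, (L <= I)%O -> (I <= H)%O -> forall x y,
       (forall j, eqm I (tnth x j) (tnth y j)) -> eqm I (F x) (F y)) ->
  congruence_preserving ([ffun x => rep (F x)] : operation A k).
Proof.
move=> FH Fp; have LH := le_trans LK KH; apply/cpP => I a b ab; rewrite !ffunE.
have [IL|LI] := cutL I.
  rewrite (@rep_eq _ (F b)) ?eqm_refl //; apply: Fp => // j.
  exact: eqm_sub IL (ab j).
have [IH|HI] := cutH I.
  apply: eqm_trans (eqm_sub LI (eqm_rep _)) _.
  apply: eqm_trans (Fp _ LI IH _ _ ab) _.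
  by rewrite eqm_sym; apply: eqm_sub LI (eqm_rep _).
apply: eqm_sub HI _; apply: eqm_in.
  by rewrite (eqm_mem (eqm_sub LH (eqm_rep _))).
by rewrite (eqm_mem (eqm_sub LH (eqm_rep _))).
Qed.

(** The gate lets [v] pass when the control argument lies in the coset of [b].  It
respects an ideal inside [K] because the control condition is then invariant, and
an ideal above [H] because its values are in [H]. *)
Lemma cp_gate b : congruence_preserving ([ffun t : 2.-tuple A =>
   rep (if eqm K (tnth t ord_max) b && (tnth t ord0 \in H)
        then tnth t ord0 else 1)] : operation A 2).
Proof.
apply: cp_rep => [t|I LI IH t u tu]; first by case: ifP => [/andP[]|].
have [IK|HI] := gap LI IH; last first.
  by apply: eqm_sub HI _; apply: eqm_in; case: ifP => // /andP[].
have -> : (tnth t ord0 \in H) = (tnth u ord0 \in H).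
  by apply: eqm_mem; apply: eqm_sub IH (tu _).
have -> : eqm K (tnth t ord_max) b = eqm K (tnth u ord_max) b.
  have tuK := eqm_sub IK (tu ord_max).
  by apply/idP/idP; apply: eqm_trans => //; rewrite eqm_sym.
by case: ifP => _ //; apply: eqm_refl.
Qed.

Definition near k (b x : k.-tuple A) := [forall j, eqm K (tnth x j) (tnth b j)].

Definition shift k (b x : k.-tuple A) : k.-tuple A :=
  [tuple tnth x j * (tnth b j)^-1 | j < k].

Lemma nearP k (b x : k.-tuple A) : reflect (all_in K (shift b x)) (near b x).
Proof.
by apply: (iffP forallP) => bx j; have := bx j; rewrite tnth_mktuple.
Qed.

(** A condition on all [k] arguments is tested one argument at a time, which keeps
the arity of the generators independent of [k]. *)
Lemma gen_gated k (b : k.-tuple A) (F : operation A k) :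
    gen F -> (forall x, F x \in H) ->
  exists2 g : operation A k, gen g &
    forall x, if near b x then eqm L (g x) (F x) else g x \in L.
Proof.
move=> gF FH.
suff [g gg gE] : exists2 g : operation A k, gen g & forall x,
    if all (fun j => eqm K (tnth x j) (tnth b j)) (enum 'I_k)
    then eqm L (g x) (F x) else g x \in L.
  exists g => // x; have := gE x.
  suff -> : near b x = all (fun j => eqm K (tnth x j) (tnth b j)) (enum 'I_k) by [].
  by apply/forallP/allP => bx j; have := bx j; rewrite ?mem_enum //; apply.
elim: (enum _) => [|j t [g gg gE]]; first by exists F => // x; apply: eqm_refl.
have LH := le_trans LK KH.
have gH x : g x \in H.
  have := gE x; case: ifP => _; last exact: (subsetP LH).
  by move=> gxF; rewrite (eqm_mem (eqm_sub LH gxF)).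
have genM : gen _ := gen_small (B_gt1 : (0 < 2 <= B)%N) (cp_gate (tnth b j)).
have := gen_comp genM (g := fun i => if i == ord0 then g else proj_op A j).
set G := comp_op _ _ => /(_ _)genG.
exists G; first by apply: genG => i; case: ifP => // _; exact: gen_proj.
move=> x; rewrite !ffunE !tnth_mktuple /= !ffunE gH andbT.
case: (eqm K _ _) => /=; last by rewrite (eqm_mem (eqm_rep _)) group1.
have := gE x; case: ifP => _ gx; last by rewrite (eqm_mem (eqm_rep _)).
exact: eqm_trans (eqm_rep _) gx.
Qed.

(** A piece of a generated operation: it follows [f], recentred at [b], on the coset
[b K ^ k], and is trivial modulo [L] elsewhere, so that pieces can be multiplied. *)
Definition realized k (b : k.-tuple A) (f : k.-tuple A -> A) :=
  exists2 g : operation A k, gen g &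
    forall x, if near b x then eqm L (g x) (f (shift b x)) else g x \in L.

Lemma realized_mul k (b : k.-tuple A) f1 f2 :
  realized b f1 -> realized b f2 -> realized b (fun x => f1 x * f2 x).
Proof.
move=> [g1 gg1 E1] [g2 gg2 E2].
exists [ffun x => g1 x * g2 x]; first exact: gen_mul.
move=> x; rewrite ffunE; have := E1 x; have := E2 x.
by case: ifP => _ ? ?; [apply: eqm_mul | apply: groupM].
Qed.

Lemma realized_trivial k (b : k.-tuple A) f : (0 < k)%N ->
  (forall x, all_in K x -> f x \in L) -> realized b f.
Proof.
move=> k0 fL; exists [ffun=> 1]; first exact: gen_one.
move=> x; rewrite ffunE; case: nearP => [bx|_]; last exact: group1.
by apply: eqm_in; rewrite ?fL.
Qed.

(** The relevant variables are renumbered to give a function of arity [B].  It is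
made trivial off the coset of [b], where nothing is known about [f]; gating then
restores the condition on the irrelevant variables. *)
Lemma realized_few_variables k (b : k.-tuple A) f (s : {set 'I_k}) :
    (0 < k)%N -> (#|s| <= B)%N -> preserving L K f ->
    (forall x, all_in K x -> f x \in H) ->
    (forall x y, all_in K x -> all_in K y ->
      (forall j, j \in s -> tnth x j = tnth y j) -> f x = f y) ->
  realized b f.
Proof.
move=> k0 sB pf fH fs; have B0 : (0 < B)%N by apply: ltnW.
pose tau (j : 'I_k) := insubd (Ordinal B0) (index j (enum s)).
pose sig (i : 'I_B) := nth (Ordinal k0) (enum s) i.
have tauK j : j \in s -> sig (tau j) = j.
  move=> js; have ij : (index j (enum s) < #|s|)%N.
    by rewrite cardE index_mem mem_enum.
  rewrite /sig val_insubd (leq_trans ij sB) nth_index ?mem_enum //.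
pose lft (z : B.-tuple A) : k.-tuple A :=
  [tuple if j \in s then tnth z (tau j) * (tnth b j)^-1 else 1 | j < k].
pose ok z := [forall j in s, eqm K (tnth z (tau j)) (tnth b j)].
have okP z : reflect (all_in K (lft z)) (ok z).
  apply: (iffP forall_inP) => zK j; rewrite ?tnth_mktuple.
    by case: ifP => // /zK.
  by move=> js; have := zK j; rewrite tnth_mktuple js.
pose F z := if ok z then f (lft z) else 1.
have cpF : congruence_preserving ([ffun z => rep (F z)] : operation A B).
  have FH z : F z \in H by rewrite /F; case: okP => // /fH.
  apply: cp_rep => // I LI IH y z yz.
  have [IK|HI] := gap LI IH; last by apply: eqm_sub HI _; apply: eqm_in.
  rewrite /F; have -> : ok y = ok z.
    apply: eq_forallb => j; congr (_ ==> _); have yzK := eqm_sub IK (yz (tau j)).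
    by apply/idP/idP; apply: eqm_trans => //; rewrite eqm_sym.
  case: (boolP (ok z)) => [zK|_]; last exact: eqm_refl.
  have yK : ok y.
    apply/forall_inP => j js; apply: eqm_trans (eqm_sub IK (yz _)) _.
    exact: (forall_inP zK).
  apply: pf => //; [exact/okP | exact/okP | move=> j].
  rewrite !tnth_mktuple; case: ifP => _; last exact: eqm_refl.
  by apply: eqm_mul => //; apply: eqm_refl.
have genF := gen_small (introT andP (conj B0 (leqnn B))) cpF.
have := gen_comp genF (fun i => gen_proj small_cp (sig i)).
set G := comp_op _ _ => genG.
have LH := le_trans LK KH.
have GE x : G x = rep (F [tuple tnth x (sig i) | i < B]).
  rewrite !ffunE; congr (rep (F _)).
  by apply: eq_from_tnth => i; rewrite !tnth_mktuple ffunE.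
have GH x : G x \in H.
  rewrite GE (eqm_mem (eqm_sub LH (eqm_rep _))) /F.
  by case: okP => // /fH.
have [g gg gE] := gen_gated b genG GH.
exists g => // x; have := gE x; case: nearP => // bx gx.
apply: eqm_trans gx _; rewrite GE; apply: eqm_trans (eqm_rep _) _.
rewrite /F; set z := [tuple _ | i < B].
have lz j : j \in s -> tnth (lft z) j = tnth (shift b x) j.
  by move=> js; rewrite !tnth_mktuple js tauK.
have zK : all_in K (lft z).
  move=> j; case: (boolP (j \in s)) => [/lz->|nj]; first exact: bx.
  by rewrite tnth_mktuple ifN.
by case: okP => // _; rewrite (fs _ (shift b x)) ?eqm_refl.
Qed.

Variable N : nat.
Hypothesis vanish : absorbing_vanish L K N.
Hypothesis NB : (N <= B)%N.

(** Each variable [j] is split off by [h x = (h x / h x[j:=1]) * h x[j:=1]]: the first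
factor absorbs [j] and the second does not depend on it.  When no variable is left
to decide, either at least [N] variables are absorbing, and the function vanishes, or
it depends on fewer than [N] variables. *)
Lemma realized_preserving k (b : k.-tuple A) f :
    (0 < k)%N -> preserving L K f -> (forall x, all_in K x -> f x \in H) ->
  realized b f.
Proof.
move=> k0.
suff H0 (t : seq 'I_k) (s : {set 'I_k}) h : preserving L K h ->
    (forall x, all_in K x -> h x \in H) ->
    (forall j, j \in s -> absorbs L K h j) ->
    (forall x y, all_in K x -> all_in K y ->
      (forall j, (j \in s) || (j \in t) -> tnth x j = tnth y j) -> h x = h y) ->
    realized b h.
  (* s collects the absorbing variables, t those still to be decided *)
  move=> pf fH; apply: (H0 (enum 'I_k) set0) => // [j|x y _ _ xy].
    by rewrite inE.
  congr (f _); apply: eq_from_tnth => j; apply: xy.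
  by rewrite mem_enum orbT.
elim: t s h => [|j t IH] s h ph hH ha hs.
  have [Ns|sN] := leqP N #|s|.
    by apply: realized_trivial => // x; apply: vanish ph ha x.
  apply: realized_few_variables ph hH _ => //.
    exact: leq_trans (ltnW sN) NB.
  by move=> x y xK yK xy; apply: hs => // i; rewrite in_nil orbF; apply: xy.
have upd1 x : all_in K x -> all_in K (upd x j 1) by move=> xK; apply: all_in_upd.
have [g gg gE] : realized b (fun x => (h x * (h (upd x j 1))^-1) * h (upd x j 1)).
  apply: realized_mul.
    apply: (IH (j |: s)).
    - apply: preserving_mul => //; apply: preserving_inv.
      exact: preserving_upd.
    - by move=> x xK; rewrite groupM ?groupV ?hH //; apply: upd1.
    - move=> i + x xK xi; rewrite in_setU1 => /predU1P[ij|si].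
        by rewrite -ij -xi upd_id mulgV.
      rewrite groupM ?groupV ?(ha i) //; first exact: upd1.
      by rewrite tnth_upd xi; case: eqP.
    - move=> x y xK yK xy; congr (_ * _^-1); apply: hs; try exact: upd1.
      - by [].
      - by [].
      - move=> i si; apply: xy; move: si; rewrite in_cons in_setU1.
        by case: (i == j); rewrite ?orbT.
      - move=> i; rewrite !tnth_upd; case: eqP => // /eqP/negPf nij si.
        by apply: xy; move: si; rewrite in_cons in_setU1 nij.
  apply: (IH s).
  - exact: preserving_upd.
  - by move=> x xK; apply/hH/upd1.
  - move=> i si x xK xi; apply: (ha i) => //; first exact: upd1.
    by rewrite tnth_upd xi; case: eqP.
  - move=> x y xK yK xy; apply: hs; try exact: upd1.
    move=> i; rewrite !tnth_upd in_cons; case: eqP => //= _; exact: xy.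
by exists g => // x; have := gE x; rewrite mulgKV.
Qed.

Lemma gen_layer k (f : operation A k) : (0 < k)%N -> congruence_preserving f ->
    (forall x, f x \in H) ->
  exists2 g : operation A k, gen g & forall x, eqm L (f x) (g x).
Proof.
move=> k0 /cpP cf fH.
suff [g gg gE] : exists2 g : operation A k, gen g & forall x,
    if has (fun b => near b x) (enum {: k.-tuple A})
    then eqm L (f x) (g x) else g x \in L.
  exists g => // x; have := gE x; case: hasP => // -[]; exists x.
    by rewrite mem_enum.
  by apply/forallP => j; apply: eqm_refl.
elim: (enum _) => [|b t [g1 gg1 g1E]] /=.
  by exists [ffun=> 1] => [|x]; [apply: gen_one | rewrite ffunE group1].
(* Cosets of K ^ k are equal or disjoint; one that has been treated must not
   be treated twice, as the factors would multiply. *)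
case: (boolP (has (near b) t)) => [|ncov].
  case/hasP => b' b't bb'; exists g1 => // x; have := g1E x.
  suff -> : near b x || has (fun c => near c x) t = has (fun c => near c x) t by [].
  apply/orb_idl => /forallP bx; apply/hasP; exists b' => //.
  apply/forallP => j; have := forallP bb' j; rewrite eqm_sym.
  by apply: eqm_trans; apply: bx.
pose f' (y : k.-tuple A) := f [tuple tnth y j * tnth b j | j < k].
have [||g2 gg2 g2E] := @realized_preserving k b f' k0.
- move=> I _ _ x y _ _ xy; apply: cf => j; rewrite !tnth_mktuple.
  by apply: eqm_mul => //; apply: eqm_refl.
- by move=> x _; apply: fH.
exists [ffun x => g1 x * g2 x]; first exact: gen_mul.
move=> x; rewrite ffunE; have := g1E x; have := g2E x.
have [bx|_] /= := boolP (near b x); last first.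
  case: ifP => _ g2L; last by move=> g1L; rewrite groupM.
  move=> fg; rewrite -[f x]mulg1; apply: eqm_mul => //.
  by rewrite eqm_sym eqm1.
have -> : has (fun c => near c x) t = false.
  apply: contraNF ncov => /hasP[c ct /forallP cx]; apply/hasP; exists c => //.
  apply/forallP => j; apply: eqm_trans (forallP bx j).
  by rewrite eqm_sym; apply: cx.
have -> : f' (shift b x) = f x.
  by congr (f _); apply: eq_from_tnth => j; rewrite !tnth_mktuple mulgKV.
move=> fg g1L; rewrite -[f x]mul1g; apply: eqm_mul; last by rewrite eqm_sym.
by rewrite eqm_sym eqm1.
Qed.

End Layer.
End Generation.

(** * Descending the chain of cutting ideals *)

Section Step.
Local Open Scope group_scope.
Variables (A : expandedGroup) (B : nat) (L H : ideal A).
Hypothesis B_large : (#|{: {ffun ideal A -> ideal A}}|.+2 <= B)%N.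
Hypotheses (cutL : cuts L) (cutH : cuts H) (LH : (L < H)%O).
Hypothesis layer :
  (forall I : ideal A, in_interval L H I <-> I = L \/ I = H)
  \/ ~ interval_splits L H.

(** A two-element interval is handled by [K = L], where every ideal of the interval
is [K] or [H], and a function of an argument in [L] is constant modulo [L]. *)
Lemma gen_layer_cases k (f : operation A k) :
    (0 < k)%N -> congruence_preserving f -> (forall x, f x \in H) ->
  exists2 g : operation A k, gen B g & forall x, eqm L (f x) (g x).
Proof.
move=> k0 cf fH; pose N := #|{: {ffun ideal A -> ideal A}}|.
have B1 : (1 < B)%N by apply: leq_trans B_large.
have NB : (N <= B)%N by apply: leq_trans B_large; exact: leqW (leqnSn _).
have [two|nosplit] := layer.
  apply: (@gen_layer _ _ B1 L L H _ _ _ _ _ N) => //; rewrite ?ltW //.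
    move=> I LI IH; have [->|->] := (two I).1 (conj LI IH).
      by left.
    by right.
  by apply: absorbing_vanish_refl; apply/card_gt0P; exists [ffun=> L].
apply: (@gen_layer _ _ B1 L H H _ _ _ _ _ N) => //; rewrite ?ltW //.
exact: absorbing_vanish_nonsplitting.
Qed.

Lemma gen_step :
    (forall k (f : operation A k), (0 < k)%N -> congruence_preserving f ->
      exists2 g : operation A k, gen B g & forall x, eqm H (f x) (g x)) ->
  forall k (f : operation A k), (0 < k)%N -> congruence_preserving f ->
    exists2 g : operation A k, gen B g & forall x, eqm L (f x) (g x).
Proof.
move=> modH k f k0 cf; have B1 : (1 < B)%N.
  by apply: leq_trans B_large.
have [g1 gg1 fg1] := modH k f k0 cf.
have ch : congruence_preserving ([ffun x => f x * (g1 x)^-1] : operation A k).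
  apply/cpP => I a b ab; rewrite !ffunE; apply: eqm_mul.
    exact: (cpP f).1.
  by apply: eqm_inv; apply: (cpP g1).1 => //; apply: gen_cp gg1.
have [|g2 gg2 hg2] := gen_layer_cases k0 ch.
  by move=> x; rewrite ffunE; apply: fg1.
exists [ffun x => g2 x * g1 x]; first exact: gen_mul.
move=> x; have := hg2 x; rewrite !ffunE => hx.
by rewrite -[f x](mulgKV (g1 x)); apply: eqm_mul => //; apply: eqm_refl.
Qed.

End Step.

Theorem theorem2p5 (A : expandedGroup) (n : nat) (S : 'I_n.+1 -> ideal A)
  (S_bot : S ord0 = \bot%O) (S_top : S ord_max = \top%O)
  (S_incr : forall i j : 'I_n.+1, (i < j)%N -> (S i < S j)%O)
  (S_cuts : forall I : ideal A, cuts I <-> exists i, I = S i)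
  (S_itv : forall i : 'I_n,
     (forall I : ideal A,
        in_interval (S (widen_ord (leqnSn n) i)) (S (lift ord0 i)) I <->
        I = S (widen_ord (leqnSn n) i) \/ I = S (lift ord0 i))
     \/ ~ interval_splits (S (widen_ord (leqnSn n) i)) (S (lift ord0 i))) :
  finitely_generated (@cp_clone A).
Proof.
pose B := #|{: {ffun ideal A -> ideal A}}|.+2.
exists (small_cp A B); split=> [k f /small_cpP[/andP[]] //|k f [k0 cf]].
suff modS m (i : 'I_n.+1) : (i + m = n)%N ->
    forall k (f : operation A k), (0 < k)%N -> congruence_preserving f ->
    exists2 g : operation A k, gen B g & forall x, eqm (S i) (f x) (g x).
  have [g gg fg] := modS n ord0 (add0n n) k f k0 cf.
  suff -> : f = g by [].
  apply/ffunP => x; apply/eqP; have := fg x.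
  by rewrite S_bot /eqm eq_mulgV1 => /set1P ->.
elim: m i => [|m IH] i im.
  have -> : i = ord_max by apply: ord_inj; rewrite -[LHS]addn0 im.
  move=> {k0 cf f}k f k0 cf; rewrite S_top.
  exists [ffun=> 1%g]; first by apply: gen_one => //.
  by move=> x; rewrite ffunE eqm1 inE.
have ltin : (i < n)%N by apply: leq_trans (eq_leq im); rewrite addnS ltnS leq_addr.
pose j := Ordinal ltin.
have ji : widen_ord (leqnSn n) j = i by apply: ord_inj.
have iS : (lift ord0 j : nat) = i.+1 by [].
have := S_itv j; rewrite ji => itv.
apply: gen_step itv _ => //.
- by apply/S_cuts; exists i.
- by apply/S_cuts; exists (lift ord0 j).
- by apply: S_incr; rewrite iS.
by apply: IH; rewrite iS addSnnS.
Qed.
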